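(* Let $A_1\in\mathbb{R}^{n_1\times n_1}$ and $A_2\in\mathbb{R}^{n_2\times n_2}$ be two strongly Schur-Horn continuous symmetric matrices whose spectrum windows have an intersection of nonzero measure, i.e. $$\mu(\omega(A_1)\cap\omega(A_2))>0,$$ where $\mu$ is the Lebesgue measure on $\mathbb{R}$. Then the matrix $A=\begin{bmatrix}A_1&0\\0&A_2\end{bmatrix}$ is also strongly Schur-Horn continuous.
   Context: The spectrum window of a symmetric matrix $A$ is the closed interval $\omega(A)=[\lambda_{\min}(A),\lambda_{\max}(A)]$, where $\lambda_{\min},\lambda_{\max}$ are the minimum and maximum eigenvalues. $\|\cdot\|_{\mathrm F}$ is the Frobenius norm; $\mathrm{diag}(M)$ is the vector of diagonal entries of a matrix $M$. Big-$O$ convention: $\varepsilon>0$ is the asymptotic variable tending to zero; perturbed quantities are families indexed by sufficiently small $\varepsilon>0$; all other data (matrix dimension, the matrix $A$) are constants. Definition (strong Schur-Horn continuity). Suppose $A\in\mathbb{R}^{n\times n}$ is a symmetric matrix with an eigendecomposition $A=Q\Lambda Q^\top$, where $Q$ is the orthonormal eigenvector matrix and $\Lambda$ is the diagonal eigenvalue matrix. $A$ is strongly Schur-Horn continuous if, for any perturbed eigenvalues $\widetilde\Lambda$ (a real diagonal matrix) satisfying $\mathrm{tr}(\widetilde\Lambda)=\mathrm{tr}(\Lambda)$ and $\|\widetilde\Lambda-\Lambda\|_{\mathrm F}=O(\varepsilon)$ for $\varepsilon>0$ sufficiently small, there exists a symmetric matrix $\widetilde B=G_2QG_1\widetilde\Lambda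 G_1^\top Q^\top G_2^\top$ such that (1) $\mathrm{diag}(\widetilde B)=\mathrm{diag}(A)$; (2) $G_1$ and $G_2$ are orthogonal matrices; (3) $\|G_i-I\|_{\mathrm F}=O(\varepsilon^{1/2})$ for $i=1,2$. *)

(* Defs.v *)
From HB Require Import structures.
From mathcomp Require Import all_boot all_order all_algebra.
From mathcomp Require Import all_classical all_reals all_analysis.

Set Implicit Arguments.
Unset Strict Implicit.
Unset Printing Implicit Defensive.

Import Order.TTheory GRing.Theory Num.Theory.
Import numFieldNormedType.Exports.

Local Open Scope classical_set_scope.
Local Open Scope ring_scope.

Definition frobenius_norm (R : realType) (m n : nat) (M : 'M[R]_(m, n)) : R :=
  Num.sqrt (\sum_(i < m) \sum_(j < n) M i j ^+ 2).

Definition diag_of (R : realType) (n : nat) (M : 'M[R]_n) : 'rV[R]_n :=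
  \row_(i < n) M i i.

Definition orthogonal_mx (R : realType) (n : nat) (Q : 'M[R]_n) : Prop :=
  Q^T *m Q = 1%:M /\ Q *m Q^T = 1%:M.

(* The set of eigenvalues is finite, and it is nonempty when A is symmetric and
   n > 0, so inf and sup below are its minimum and its maximum. For n = 0 both
   are 0, and the window [0, 0] is a null set. *)
Definition lambda_min (R : realType) (n : nat) (A : 'M[R]_n) : R :=
  inf [set a | eigenvalue A a].

Definition lambda_max (R : realType) (n : nat) (A : 'M[R]_n) : R :=
  sup [set a | eigenvalue A a].

Definition spectrum_window (R : realType) (n : nat) (A : 'M[R]_n) : set R :=
  `[lambda_min A, lambda_max A].

(* A diagonal matrix is given by the row vector of its diagonal entries.
   Perturbed quantities are functions of eps of which only the values at small
   eps > 0 matter, whence the filter 0^'+. The eigendecomposition A = Q L Q^T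
   is part of the data witnessing the property: it is chosen before, hence
   independently of, the perturbation Lt and eps. *)
Definition strongly_schur_horn_continuous (R : realType) (n : nat)
    (A : 'M[R]_n) : Prop :=
  A \is symmetricmx /\
  exists (Q : 'M[R]_n) (L : 'rV[R]_n),
    [/\ orthogonal_mx Q,
        A = Q *m diag_mx L *m Q^T &
        forall Lt : R -> 'rV[R]_n,
          (\forall eps \near 0^'+, \tr (diag_mx (Lt eps)) = \tr (diag_mx L)) ->
          (fun eps => frobenius_norm (diag_mx (Lt eps) - diag_mx L))
            =O_ (0^'+) (fun eps => eps) ->
          exists Bt G1 G2 : R -> 'M[R]_n,
            [/\ (\forall eps \near 0^'+,
                  [/\ Bt eps \is symmetricmx,
                      Bt eps = G2 eps *m Q *m G1 eps *m diag_mx (Lt eps)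
                               *m (G1 eps)^T *m Q^T *m (G2 eps)^T,
                      diag_of (Bt eps) = diag_of A,
                      orthogonal_mx (G1 eps) &
                      orthogonal_mx (G2 eps)]),
                (fun eps => frobenius_norm (G1 eps - 1%:M))
                  =O_ (0^'+) (fun eps => Num.sqrt eps) &
                (fun eps => frobenius_norm (G2 eps - 1%:M))
                  =O_ (0^'+) (fun eps => Num.sqrt eps)]].

(* Main.v *)
Require Import Defs.
From mathcomp Require Import all_boot all_order all_algebra.
From mathcomp Require Import all_classical all_reals all_analysis.
From mathcomp Require Import ring lra.
Import Order.TTheory GRing.Theory Num.Theory.
Import numFieldNormedType.Exports.
Local Open Scope classical_set_scope.
Local Open Scope ring_scope.

(** A perturbation of the joint spectrum may move an amount [d = O(eps)] of trace
    from one block to the other. Since the windows overlap in an interval, there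
    are eigenvalues [a1 > b1] and [a2 < b2] with [a1], [a2] from the first block
    and [b1], [b2] from the second. According to the sign of [d], a Givens
    rotation by an angle [O(sqrt eps)] in the plane of one of these pairs returns
    [d] to its block. It leaves both diagonal blocks diagonal, so the property of
    each block applies to it; the off-diagonal blocks that the rotation creates
    do not meet the diagonal when the block-diagonal matrices are applied. *)

(** * Symmetric and orthogonal matrices *)

Lemma symmetricmxP (R : realType) (n : nat) (A : 'M[R]_n) :
  A \is symmetricmx <-> A^T = A.
Proof.
split=> [/is_hermitianmxP|h]; last apply/is_hermitianmxP.
  by rewrite expr0 scale1r map_mx_id // => {2}->.
by rewrite expr0 scale1r map_mx_id.
Qed.

Lemma symmetric_conj_diag (R : realType) (m n : nat) (X : 'M[R]_(m, n)) d :
  X *m diag_mx d *m X^T \is symmetricmx.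
Proof. by apply/symmetricmxP; rewrite !trmx_mul trmxK tr_diag_mx mulmxA. Qed.

Lemma orthogonal_mx_mul (R : realType) (n : nat) (U V : 'M[R]_n) :
  orthogonal_mx U -> orthogonal_mx V -> orthogonal_mx (U *m V).
Proof.
move=> [UU1 UU2] [VV1 VV2]; split; rewrite trmx_mul mulmxA.
  by rewrite -(mulmxA V^T) UU1 mulmx1.
by rewrite -(mulmxA U) VV2 mulmx1.
Qed.

Lemma orthogonal_block_diag (R : realType) (m n : nat) (U : 'M[R]_m)
    (V : 'M[R]_n) :
  orthogonal_mx U -> orthogonal_mx V -> orthogonal_mx (block_mx U 0 0 V).
Proof.
by move=> [UU1 UU2] [VV1 VV2]; split;
  rewrite tr_block_mx !trmx0 mulmx_block ?UU1 ?UU2 ?VV1 ?VV2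
          !(mulmx0, mul0mx) !(addr0, add0r) -scalar_mx_block.
Qed.

(** * The Frobenius norm *)

Lemma sqr_frobenius_norm (R : realType) (m n : nat) (M : 'M[R]_(m, n)) :
  frobenius_norm M ^+ 2 = \tr (M *m M^T).
Proof.
rewrite sqr_sqrtr; last by do 2 apply: sumr_ge0 => ? _; apply: sqr_ge0.
rewrite /mxtrace; apply: eq_bigr => i _; rewrite mxE; apply: eq_bigr => j _.
by rewrite mxE expr2.
Qed.

Lemma frobenius_norm_ge0 (R : realType) (m n : nat) (M : 'M[R]_(m, n)) :
  0 <= frobenius_norm M.
Proof. exact: sqrtr_ge0. Qed.

(* Half of the parallelogram law; it replaces the triangle inequality, whose
   proof would need Cauchy-Schwarz. *)
Lemma sqr_frobenius_normD (R : realType) (m n : nat) (M N : 'M[R]_(m, n)) :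
  frobenius_norm (M + N) ^+ 2 <=
  2 * (frobenius_norm M ^+ 2 + frobenius_norm N ^+ 2).
Proof.
rewrite !sqr_sqrtr; do ?by do 2 apply: sumr_ge0 => ? _; apply: sqr_ge0.
rewrite -big_split mulr_sumr; apply: ler_sum => i _ /=.
rewrite -big_split mulr_sumr; apply: ler_sum => j _ /=.
rewrite mxE; have := sqr_ge0 (M i j - N i j); nra.
Qed.

Lemma frobenius_norm_mulr_orthogonal (R : realType) (m n : nat)
    (M : 'M[R]_(m, n)) (U : 'M[R]_n) :
  orthogonal_mx U -> frobenius_norm (M *m U) ^+ 2 = frobenius_norm M ^+ 2.
Proof.
move=> [_ UU]; rewrite !sqr_frobenius_norm trmx_mul mulmxA -(mulmxA M) UU.
by rewrite mulmx1.
Qed.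

Lemma sqr_frobenius_norm_block_diag (R : realType) (m n : nat) (M : 'M[R]_m)
    (N : 'M[R]_n) :
  frobenius_norm (block_mx M 0 0 N) ^+ 2 =
  frobenius_norm M ^+ 2 + frobenius_norm N ^+ 2.
Proof.
rewrite !sqr_frobenius_norm tr_block_mx !trmx0 mulmx_block.
by rewrite !(mulmx0, mul0mx) !(addr0, add0r) mxtrace_block.
Qed.

Lemma sqr_frobenius_norm_diag (R : realType) (n : nat) (v : 'rV[R]_n) :
  frobenius_norm (diag_mx v) ^+ 2 = \sum_k v 0 k ^+ 2.
Proof.
rewrite sqr_frobenius_norm tr_diag_mx mulmx_diag mxtrace_diag.
by apply: eq_bigr => k _; rewrite mxE expr2.
Qed.

Lemma norm_le_frobenius_diag (R : realType) (n : nat) (v : 'rV[R]_n) k :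
  `|v 0 k| <= frobenius_norm (diag_mx v).
Proof.
rewrite -ler_sqr ?nnegrE ?frobenius_norm_ge0// sqr_frobenius_norm_diag.
rewrite real_normK ?num_real// (bigD1 k)//= lerDl.
by apply: sumr_ge0 => i _; apply: sqr_ge0.
Qed.

(** The sum of squares is at most [n * C ^+ 2], hence at most [(n * C) ^+ 2]. The factor [n] in
    place of its square root is harmless in a big-O bound. *)
Lemma frobenius_diag_le (R : realType) (n : nat) (v : 'rV[R]_n) (C : R) :
  0 <= C -> (forall k, `|v 0 k| <= C) ->
  frobenius_norm (diag_mx v) <= n%:R * C.
Proof.
move=> C0 vC; rewrite -ler_sqr ?nnegrE ?frobenius_norm_ge0 ?mulr_ge0//.
rewrite sqr_frobenius_norm_diag.
have : \sum_k v 0 k ^+ 2 <= \sum_(k < n) C ^+ 2.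
  apply: ler_sum => k _; rewrite -(real_normK (num_real _)) ler_sqr//.
move=> /le_trans; apply; rewrite sumr_const card_ord exprMn -[leLHS]mulr_natl.
rewrite ler_wpM2r ?sqr_ge0// -natrX ler_nat -mulnn.
by case: n {v vC} => // n; rewrite leq_pmulr.
Qed.

(** * Explicit constants for the big-O conditions *)

Lemma bigO_idP (R : realType) (f : R -> R) :
  f =O_ (0^'+) (fun eps => eps) <->
  exists2 C : R, 0 <= C & \forall eps \near 0^'+, `|f eps| <= C * eps.
Proof.
rewrite eqO_exP; split=> [[C C0 fC]|[C C0 fC]].
  exists C; first exact: ltW.
  near=> eps; have eps0 : 0 < eps by [].
  rewrite -[X in _ * X](ger0_norm (ltW eps0)); near: eps; exact: fC.
(* The big-O constant must be positive, while [C] may be 0. *)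
exists (C + 1); first by rewrite ltr_wpDl.
near=> eps; have eps0 : 0 < eps by [].
rewrite (ger0_norm (ltW eps0)); apply: (@le_trans _ _ (C * eps)).
  by near: eps.
by rewrite ler_wpM2r ?ltW// ltrDl.
Unshelve. all: by end_near. Qed.

(** Squared Frobenius norms add over diagonal blocks and are invariant under orthogonal factors, so
    the square-root bounds are handled as linear bounds on squares. *)
Lemma bigO_sqrtP (R : realType) (f : R -> R) :
  f =O_ (0^'+) (fun eps => Num.sqrt eps) <->
  exists2 K : R, 0 <= K & \forall eps \near 0^'+, f eps ^+ 2 <= K * eps.
Proof.
rewrite eqO_exP; split=> [[C C0 fC]|[K K0 fK]].
  exists (C ^+ 2); first exact: sqr_ge0.
  near=> eps; have eps0 : 0 < eps by [].
  rewrite -(real_normK (num_real (f eps))) -[X in _ * X]sqr_sqrtr ?(ltW eps0)//.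
  rewrite -exprMn ler_sqr ?nnegrE ?mulr_ge0 ?sqrtr_ge0 ?(ltW C0)//.
  rewrite -[X in _ * X](ger0_norm (sqrtr_ge0 _)); near: eps; exact: fC.
exists (Num.sqrt (K + 1)); first by rewrite sqrtr_gt0 ltr_wpDl.
near=> eps; have eps0 : 0 < eps by [].
rewrite (ger0_norm (sqrtr_ge0 _)) -ler_sqr ?nnegrE ?mulr_ge0 ?sqrtr_ge0//.
rewrite real_normK ?num_real// exprMn !sqr_sqrtr ?addr_ge0 ?(ltW eps0)//.
apply: (@le_trans _ _ (K * eps)); first by near: eps.
by rewrite ler_pM2r// lerDl.
Unshelve. all: by end_near. Qed.

(** * Eigenvalues and spectrum windows *)

Lemma eigenvalue_conj_diag (R : realType) (n : nat) (Q : 'M[R]_n)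
    (L : 'rV[R]_n) (a : R) :
  orthogonal_mx Q -> eigenvalue (Q *m diag_mx L *m Q^T) a ->
  exists k, L 0 k = a.
Proof.
move=> [QQ1 QQ2] /eigenvalueP[v va v0].
(* The row vector [v *m Q] is an eigenvector of [diag_mx L]; the eigenvalue equation at a nonzero
   coordinate [k] identifies [a] with [L 0 k]. *)
have w0 : v *m Q != 0.
  apply: contra_neq v0 => vQ.
  by rewrite -(mulmx1 v) -QQ2 mulmxA vQ mul0mx.
have [k wk] : exists k, (v *m Q) 0 k != 0.
  by case/rV0Pn: w0 => k; exists k.
exists k; have : v *m Q *m diag_mx L = a *: (v *m Q).
  by rewrite scalemxAl -va -!mulmxA QQ1 mulmx1.
move=> /matrixP/(_ 0 k); rewrite mul_mx_diag !mxE mulrC => h.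
by apply: (mulIf wk); rewrite mxE.
Qed.

Lemma lebesgue_measure_gt0_lt (R : realType) (S : set R) (a b : R) :
  measurable S -> S `<=` `[a, b] -> (0 < lebesgue_measure S)%E -> a < b.
Proof.
move=> mS Sab S0; rewrite ltNge; apply/negP => ba.
have : (lebesgue_measure S <= lebesgue_measure (`[a, b] : set R))%E.
  by apply: le_measure => //; rewrite inE//; exact: measurable_itv.
rewrite lebesgue_measure_itv /= lte_fin ltNge ba /=.
by move=> /(lt_le_trans S0); rewrite ltxx.
Qed.

(** Otherwise every eigenvalue of [A2] is at most every eigenvalue of [A1], so
    [lambda_max A2 <= lambda_min A1] and the windows share at most one point. *)
Lemma eigenvalue_lt_of_window (R : realType) (m n : nat)
    (Q1 : 'M[R]_m) (L1 : 'rV[R]_m) (Q2 : 'M[R]_n) (L2 : 'rV[R]_n) :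
  let A1 := Q1 *m diag_mx L1 *m Q1^T in
  let A2 := Q2 *m diag_mx L2 *m Q2^T in
  orthogonal_mx Q1 -> orthogonal_mx Q2 ->
  (0 < lebesgue_measure (spectrum_window A1 `&` spectrum_window A2))%E ->
  exists i j, L1 0 i < L2 0 j.
Proof.
move=> A1 A2 oQ1 oQ2 hw.
have mW : measurable (spectrum_window A1 `&` spectrum_window A2).
  by apply: measurableI; exact: measurable_itv.
have h1 : lambda_min A1 < lambda_max A1.
  by apply: (lebesgue_measure_gt0_lt _ _ _ _ mW _ hw) => x [].
have h2 : lambda_min A2 < lambda_max A2.
  by apply: (lebesgue_measure_gt0_lt _ _ _ _ mW _ hw) => x [].
have h12 : lambda_min A1 < lambda_max A2.
  apply: (lebesgue_measure_gt0_lt _ _ _ _ mW _ hw) => x [].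
  rewrite /spectrum_window /= !in_itv /= => /andP[h _] /andP[_ h'].
  by rewrite h h'.
(* An empty spectrum would have [inf] and [sup] both equal to 0, against the strict inequality
   [h1]. *)
have ne1 : [set a | eigenvalue A1 a] !=set0.
  apply/set0P/negP => /eqP E.
  by move: h1; rewrite /lambda_min /lambda_max E inf0 sup0 ltxx.
have ne2 : [set a | eigenvalue A2 a] !=set0.
  apply/set0P/negP => /eqP E.
  by move: h2; rewrite /lambda_min /lambda_max E inf0 sup0 ltxx.
apply: contrapT => /forallNP H; move: h12; rewrite ltNge => /negP; apply.
apply: ge_sup => // b eb; apply: lb_le_inf => // a ea.
have [i <-] := eigenvalue_conj_diag _ _ _ _ _ oQ1 ea.
have [j <-] := eigenvalue_conj_diag _ _ _ _ _ oQ2 eb.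
by rewrite leNgt; apply/negP => lt; apply: (H i); exists j.
Qed.

(** * Givens rotations across the two blocks *)

Definition givens_diag (R : realType) (n : nat) (i : 'I_n) (c : R) : 'rV[R]_n :=
  \row_k (if k == i then c else 1).

(** With [c] a cosine and [s] the matching sine, this is the rotation in the plane of coordinate [i]
    of the first block and coordinate [j] of the second. *)
Definition givens_mx (R : realType) (m n : nat) (i : 'I_m) (j : 'I_n)
    (c s : R) : 'M[R]_(m + n) :=
  block_mx (diag_mx (givens_diag R m i c)) (- s *: delta_mx i j)
           (s *: delta_mx j i) (diag_mx (givens_diag R n j c)).

Lemma diag_mul_delta (R : realType) (m n : nat) (d : 'rV[R]_m) (i : 'I_m)
    (j : 'I_n) :
  diag_mx d *m delta_mx i j = d 0 i *: delta_mx i j.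
Proof.
apply/matrixP => k l; rewrite mul_diag_mx !mxE.
by have [->//|] := eqVneq k i; rewrite !mulr0.
Qed.

Lemma delta_mul_diag (R : realType) (m n : nat) (d : 'rV[R]_n) (i : 'I_m)
    (j : 'I_n) :
  delta_mx i j *m diag_mx d = d 0 j *: delta_mx i j.
Proof.
by apply: trmx_inj; rewrite trmx_mul linearZ /= !trmx_delta tr_diag_mx diag_mul_delta.
Qed.

Lemma delta_mx_diag (R : realType) (n : nat) (i : 'I_n) :
  delta_mx i i = diag_mx (delta_mx 0 i) :> 'M[R]_n.
Proof.
apply/matrixP => k l; rewrite !mxE eqxx /=.
have [->|kl] := eqVneq k l; first by rewrite andbb mulr1n.
by rewrite mulr0n; case: (eqVneq l i) kl => [->|]; [move/negPf-> | rewrite andbF].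
Qed.

Lemma givens_orthogonal (R : realType) (m n : nat) (i : 'I_m) (j : 'I_n)
    (c s : R) :
  c ^+ 2 + s ^+ 2 = 1 -> orthogonal_mx (givens_mx R m n i j c s).
Proof.
move=> cs; suff h : givens_mx R m n i j c s *m (givens_mx R m n i j c s)^T = 1%:M.
  by split=> //; exact: mulmx1C.
rewrite tr_block_mx mulmx_block !tr_diag_mx !linearZ /= !trmx_delta.
rewrite -!(scalemxAl, scalemxAr) !mul_delta_mx diag_mul_delta delta_mul_diag.
rewrite !diag_mul_delta !delta_mul_diag !mxE !eqxx !scalerA !mulmx_diag.
rewrite !delta_mx_diag.
(* Serves both diagonal blocks of the product; [x] is [- s * - s] in the first and [s * s] in the
   second. *)
have dE k (l : 'I_k) (x : R) : x = s * s ->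
  diag_mx (\row_p (givens_diag R k l c 0 p * givens_diag R k l c 0 p)) +
  x *: diag_mx (delta_mx 0 l) = 1%:M.
  move=> ->; rewrite -[_ *: diag_mx _]linearZ -linearD /= -diag_const_mx; congr diag_mx.
  apply/rowP => p; rewrite !mxE eqxx /=; case: eqP => _.
    by rewrite mulr1 -cs !expr2.
  by rewrite mulr0 addr0 mulr1.
rewrite dE; last by rewrite mulrNN.
rewrite [_ *: diag_mx _ + _]addrC dE // scalar_mx_block; congr block_mx.
  by rewrite -scalerDl; rewrite (_ : _ + _ = 0) ?scale0r//; ring.
by rewrite -scalerDl; rewrite (_ : _ + _ = 0) ?scale0r//; ring.
Qed.

(** The rotation plane meets each block in a single coordinate, so both diagonal blocks stay
    diagonal and only [u 0 i] and [v 0 j] are mixed, with weights [c ^+ 2] and [s ^+ 2]. [X] and [Y]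
    stay unspecified because they never reach the diagonal. *)
Lemma givens_conj_diag (R : realType) (m n : nat) (i : 'I_m) (j : 'I_n)
    (c s : R) (u : 'rV[R]_m) (v : 'rV[R]_n) :
  c ^+ 2 + s ^+ 2 = 1 ->
  let G := givens_mx R m n i j c s in
  let d := s ^+ 2 * (u 0 i - v 0 j) in
  exists X Y, G *m diag_mx (row_mx u v) *m G^T =
    block_mx (diag_mx (u - d *: delta_mx 0 i)) X
             Y (diag_mx (v + d *: delta_mx 0 j)).
Proof.
move=> cs G d; have c2 : c ^+ 2 = 1 - s ^+ 2 by rewrite -cs addrK.
rewrite /G diag_mx_row tr_block_mx !mulmx_block.
rewrite !tr_diag_mx !linearZ /= !trmx_delta !(mulmx0, addr0, add0r).
do 2 eexists; congr block_mx.
  rewrite -!(scalemxAl, scalemxAr) !delta_mul_diag.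
  rewrite -!scalemxAl !mul_delta_mx !mulmx_diag !delta_mx_diag.
  rewrite -![_ *: diag_mx _]linearZ -linearD /=; congr diag_mx.
  apply/rowP => p; rewrite !mxE eqxx /=; case: eqP => [->|_] /=.
    transitivity (c ^+ 2 * u 0 i + s ^+ 2 * v 0 j); first ring.
    rewrite c2 /d; ring.
  ring.
rewrite -!(scalemxAl, scalemxAr) !delta_mul_diag.
rewrite -!scalemxAl !mul_delta_mx !mulmx_diag !delta_mx_diag.
rewrite -![_ *: diag_mx _]linearZ -linearD /=; congr diag_mx.
apply/rowP => p; rewrite !mxE eqxx /=; case: eqP => [->|_] /=.
  transitivity (c ^+ 2 * v 0 j + s ^+ 2 * u 0 i); first ring.
  rewrite c2 /d; ring.
ring.
Qed.

Lemma mxtrace_givens (R : realType) (m n : nat) (i : 'I_m) (j : 'I_n)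
    (c s : R) :
  \tr (givens_mx R m n i j c s) = m%:R + n%:R - 2 * (1 - c).
Proof.
have dE k (l : 'I_k) : \sum_p givens_diag R k l c 0 p = k%:R - (1 - c).
  rewrite (eq_bigr (fun p => 1 - (if p == l then 1 - c else 0))).
    by rewrite sumrB sumr_const card_ord -big_mkcond big_pred1_eq.
  by move=> p _; rewrite mxE; case: eqP => _; ring.
rewrite mxtrace_block !mxtrace_diag !dE; ring.
Qed.

(** Expanding [(U - 1) *m (U - 1)^T] gives [2 - U - U^T], whose trace is the right-hand side. *)
Lemma sqr_frobenius_norm_orthogonal_sub1 (R : realType) (n : nat) (U : 'M[R]_n) :
  orthogonal_mx U -> frobenius_norm (U - 1%:M) ^+ 2 = 2 * (n%:R - \tr U).
Proof.
move=> [_ UU]; rewrite sqr_frobenius_norm linearB /= trmx1.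
rewrite mulmxBl !mulmxBr UU !mulmx1 !mul1mx !linearB /= mxtrace1 mxtrace_tr.
ring.
Qed.

(** * Moving trace from one block to the other *)

Lemma givens_transfer (R : realType) (m n : nat) (u : 'rV[R]_m) (v : 'rV[R]_n)
    (i : 'I_m) (j : 'I_n) (d : R) :
  let t := d / (u 0 i - v 0 j) in
  u 0 i - v 0 j != 0 -> 0 <= t <= 1 ->
  exists U X Y,
    [/\ orthogonal_mx U,
        U *m diag_mx (row_mx u v) *m U^T =
          block_mx (diag_mx (u - d *: delta_mx 0 i)) X
                   Y (diag_mx (v + d *: delta_mx 0 j)) &
        frobenius_norm (U - 1%:M) ^+ 2 <= 4 * t].
Proof.
(* The rotation moves [s ^+ 2 * (u 0 i - v 0 j)], so moving [d] forces [s ^+ 2 = t]. *)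
move=> t uv /andP[t0 t1]; set c := Num.sqrt (1 - t); set s := Num.sqrt t.
have s2 : s ^+ 2 = t by rewrite sqr_sqrtr.
have c2 : c ^+ 2 = 1 - t by rewrite sqr_sqrtr // subr_ge0.
have cs : c ^+ 2 + s ^+ 2 = 1 by rewrite s2 c2 subrK.
have oU := givens_orthogonal R m n i j c s cs.
have [X [Y UE]] := givens_conj_diag R m n i j c s u v cs.
exists (givens_mx R m n i j c s), X, Y; split=> //.
  by rewrite UE s2 /t divfK.
(* The squared norm is [4 * (1 - c)], and [c >= c ^+ 2 = 1 - t] because [c] lies between 0 and 1. *)
rewrite sqr_frobenius_norm_orthogonal_sub1// mxtrace_givens natrD.
have c0 : 0 <= c by exact: sqrtr_ge0.
nra.
Qed.

(** The constant depends only on the unperturbed spectra, hence is uniform in [eps]. If [x] is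
    small, the perturbed gaps stay at least half the original ones, so an excess of order [x] needs
    only [s ^+ 2] of order [x]. *)
Lemma trace_transfer (R : realType) (m n : nat) (L1 : 'rV[R]_m)
    (L2 : 'rV[R]_n) (i1 i2 : 'I_m) (j1 j2 : 'I_n) :
  L2 0 j1 < L1 0 i1 -> L1 0 i2 < L2 0 j2 ->
  exists2 K : R, 0 < K &
  forall (x : R) (u : 'rV[R]_m) (v : 'rV[R]_n), 0 <= x -> K * x <= 1 ->
    (forall k, `|u 0 k - L1 0 k| <= x) -> (forall k, `|v 0 k - L2 0 k| <= x) ->
    \sum_k u 0 k + \sum_k v 0 k = \sum_k L1 0 k + \sum_k L2 0 k ->
  exists U X Y u' v',
    [/\ orthogonal_mx U,
        U *m diag_mx (row_mx u v) *m U^T =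
          block_mx (diag_mx u') X Y (diag_mx v'),
        frobenius_norm (U - 1%:M) ^+ 2 <= K * x,
        \sum_k u' 0 k = \sum_k L1 0 k /\ \sum_k v' 0 k = \sum_k L2 0 k &
        (forall k, `|u' 0 k - L1 0 k| <= K * x) /\
        (forall k, `|v' 0 k - L2 0 k| <= K * x)].
Proof.
move=> gap1 gap2.
set g := Num.min (L1 0 i1 - L2 0 j1) (L2 0 j2 - L1 0 i2).
have g0 : 0 < g by rewrite lt_min !subr_gt0 gap1 gap2.
have g1 : g <= L1 0 i1 - L2 0 j1 by rewrite ge_min lexx.
have g2 : g <= L2 0 j2 - L1 0 i2 by rewrite ge_min lexx orbT.
set N : R := m%:R; have N0 : 0 <= N by exact: ler0n.
(* In [K * g >= 8 * N + 4], the term 4 ensures [4 * x <= g], which keeps the gaps above [g / 2], and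
   [8 * N] bounds the rotation. The summand [N + 1] bounds the new entries, which are off by at most
   [x + N * x]. *)
set K := (8 * N + 4) / g + N + 1.
have Kg : 8 * N + 4 <= K * g.
  have gg : (8 * N + 4) / g * g = 8 * N + 4 by rewrite divfK ?gt_eqF.
  rewrite /K; nra.
have KN : N + 1 <= K.
  have : 0 <= (8 * N + 4) / g by rewrite divr_ge0 ?(ltW g0)//; lra.
  rewrite /K; lra.
exists K; first by lra.
move=> x u v x0 Kx hu hv tr_uv.
(* The excess of trace in the first block; by the trace equality the second block lacks the same
   amount. *)
set d := \sum_k u 0 k - \sum_k L1 0 k.
have dx : `|d| <= N * x.
  rewrite /d -sumrB; apply: le_trans (ler_norm_sum _ _ _) _.
  apply: le_trans (ler_sum _ (fun k _ => hu k)) _.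
  by rewrite sumr_const card_ord /N mulr_natl.
have Nx0 : 0 <= N * x by exact: mulr_ge0.
have Kgx : (8 * N + 4) * x <= K * g * x by rewrite ler_wpM2r.
have xg : 4 * x <= g.
  have : g * (K * x) <= g * 1 by rewrite ler_wpM2l// ltW.
  lra.
(* the sign of d decides in which direction trace has to be moved *)
have [i [j [h1 h2]]] : exists i j,
    0 <= d / (u 0 i - v 0 j) /\ g / 2 <= `|u 0 i - v 0 j|.
  have [d0|d0] := leP 0 d.
    exists i1, j1; have e1 := hu i1; have e2 := hv j1.
    have h : g / 2 <= u 0 i1 - v 0 j1.
      by move: e1 e2; rewrite !ler_norml => /andP[? ?] /andP[? ?]; lra.
    have h' : 0 <= u 0 i1 - v 0 j1 by lra.
    by split; [exact: divr_ge0 | rewrite ger0_norm].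
  exists i2, j2; have e1 := hu i2; have e2 := hv j2.
  have h : g / 2 <= - (u 0 i2 - v 0 j2).
    by move: e1 e2; rewrite !ler_norml => /andP[? ?] /andP[? ?]; lra.
  have h' : u 0 i2 - v 0 j2 <= 0 by lra.
  split; last by rewrite ler0_norm.
  by rewrite -mulrNN -invrN divr_ge0 ?oppr_ge0// ltW.
have uv0 : 0 < `|u 0 i - v 0 j| by lra.
(* Together with [K * x <= 1] this also gives the condition [t <= 1] of [givens_transfer]. *)
have tK : 4 * (d / (u 0 i - v 0 j)) <= K * x.
  rewrite -(ger0_norm h1) normrM normfV mulrA ler_pdivrMr//.
  have : K * x * (g / 2) <= K * x * `|u 0 i - v 0 j|.
    by rewrite ler_wpM2l// mulr_ge0//; lra.
  lra.
have [U [X [Y [oU UE Un]]]] : exists U X Y,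
    [/\ orthogonal_mx U,
        U *m diag_mx (row_mx u v) *m U^T =
          block_mx (diag_mx (u - d *: delta_mx 0 i)) X
                   Y (diag_mx (v + d *: delta_mx 0 j)) &
        frobenius_norm (U - 1%:M) ^+ 2 <= 4 * (d / (u 0 i - v 0 j))].
  apply: givens_transfer; first by rewrite -normr_gt0.
  rewrite h1 /=; lra.
have sum_delta k (l : 'I_k) : \sum_p (d *: delta_mx 0 l : 'rV[R]_k) 0 p = d.
  rewrite (bigD1 l)//= big1 ?addr0 => [|p /negPf pl]; rewrite !mxE eqxx ?eqxx.
    by rewrite mulr1.
  by rewrite pl mulr0.
have delta_le k (l p : 'I_k) : `|(d *: delta_mx 0 l : 'rV[R]_k) 0 p| <= N * x.
  rewrite !mxE eqxx /=; case: eqP => _; rewrite ?mulr1//.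
  by rewrite mulr0 normr0 mulr_ge0.
exists U, X, Y, (u - d *: delta_mx 0 i), (v + d *: delta_mx 0 j).
split=> //; first exact: le_trans Un tK.
  split.
    under eq_bigr do rewrite mxE [X in _ + X]mxE.
    by rewrite sumrB sum_delta /d; ring.
  under eq_bigr do rewrite mxE.
  rewrite big_split /= sum_delta /d; move: tr_uv; lra.
have NxK : x + N * x <= K * x.
  have : (N + 1) * x <= K * x by rewrite ler_wpM2r.
  lra.
split=> k; rewrite mxE.
  rewrite [X in _ + X - _]mxE addrAC; apply: le_trans (ler_normB _ _) _.
  by apply: le_trans NxK; apply: lerD.
rewrite addrAC; apply: le_trans (ler_normD _ _) _.
by apply: le_trans NxK; apply: lerD.
Qed.

(** * Assembling the two blocks *)

Theorem lemma3p7 (R : realType) (n1 n2 : nat)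
    (A1 : 'M[R]_n1) (A2 : 'M[R]_n2)
    (hA1 : strongly_schur_horn_continuous A1)
    (hA2 : strongly_schur_horn_continuous A2)
    (hw : (0 < lebesgue_measure
                 (spectrum_window A1 `&` spectrum_window A2))%E) :
  strongly_schur_horn_continuous (block_mx A1 0 0 A2).
Proof.
case: hA1 => sA1 [Q1 [L1 [oQ1 A1E H1]]].
case: hA2 => sA2 [Q2 [L2 [oQ2 A2E H2]]].
have hw12 := hw; rewrite A1E A2E in hw12; have hw21 := hw12; rewrite setIC in hw21.
have [i2 [j2 gap2]] := eigenvalue_lt_of_window _ _ _ _ _ _ _ oQ1 oQ2 hw12.
have [j1 [i1 gap1]] := eigenvalue_lt_of_window _ _ _ _ _ _ _ oQ2 oQ1 hw21.
have [K K0 HK] := trace_transfer R n1 n2 L1 L2 i1 i2 j1 j2 gap1 gap2.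
have AE : block_mx A1 0 0 A2 =
    block_mx Q1 0 0 Q2 *m diag_mx (row_mx L1 L2) *m (block_mx Q1 0 0 Q2)^T.
  rewrite diag_mx_row tr_block_mx !trmx0 !mulmx_block.
  by rewrite !(mulmx0, mul0mx, addr0, add0r) -A1E -A2E.
split; first by rewrite AE; exact: symmetric_conj_diag.
exists (block_mx Q1 0 0 Q2), (row_mx L1 L2).
split=> //; first exact: orthogonal_block_diag.
move=> Lt trLt /bigO_idP[C C0 LtC].
(* The conclusion of [trace_transfer] at [x = C * eps], packed into one triple so that a single
   choice over [eps] yields the three families. *)
pose good eps (w : 'M[R]_(n1 + n2) * 'rV[R]_n1 * 'rV[R]_n2) :=
  let: (U, u', v') := w in
  [/\ orthogonal_mx U,
      exists X Y, U *m diag_mx (Lt eps) *m U^T =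
        block_mx (diag_mx u') X Y (diag_mx v'),
      frobenius_norm (U - 1%:M) ^+ 2 <= K * (C * eps),
      \sum_k u' 0 k = \sum_k L1 0 k /\ \sum_k v' 0 k = \sum_k L2 0 k &
      (forall k, `|u' 0 k - L1 0 k| <= K * (C * eps)) /\
      (forall k, `|v' 0 k - L2 0 k| <= K * (C * eps))].
have KC0 : 0 <= K * C by rewrite mulr_ge0// ltW.
have small : \forall eps \near 0^'+, K * (C * eps) <= 1.
  have KC1 : 0 < K * C + 1 by rewrite ltr_wpDl.
  near=> eps; have eps0 : 0 < eps by [].
  have : eps <= (K * C + 1)^-1.
    by near: eps; apply: nbhs_right_le; rewrite invr_gt0.
  rewrite -[_^-1]mul1r ler_pdivlMr// mulrDr mulr1 mulrC mulrA.
  by apply: le_trans; rewrite lerDl ltW.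
have exw : \forall eps \near 0^'+, exists w, good eps w.
  near=> eps; have eps0 : 0 < eps by [].
  have LtCe : `|frobenius_norm (diag_mx (Lt eps) - diag_mx (row_mx L1 L2))|
      <= C * eps by near: eps.
  have entry k : `|Lt eps 0 k - row_mx L1 L2 0 k| <= C * eps.
    rewrite ger0_norm ?frobenius_norm_ge0// -linearB /= in LtCe.
    by have := le_trans (norm_le_frobenius_diag _ _ _ k) LtCe; rewrite !mxE.
  have [|||||U [X [Y [u' [v' [h1 h2 h3 h4 h5]]]]]] :=
      HK (C * eps) (lsubmx (Lt eps)) (rsubmx (Lt eps)).
  - by rewrite mulr_ge0// ltW.
  - by near: eps.
  - by move=> k; have := entry (lshift n2 k); rewrite row_mxEl mxE.
  - by move=> k; have := entry (rshift n1 k); rewrite row_mxEr mxE.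
  - have : \tr (diag_mx (Lt eps)) = \tr (diag_mx (row_mx L1 L2)) by near: eps.
    rewrite !mxtrace_diag !big_split_ord /=.
    under eq_bigr do rewrite -[Lt eps]hsubmxK row_mxEl.
    under [X in _ + X = _ -> _]eq_bigr do rewrite -[Lt eps]hsubmxK row_mxEr.
    under [X in _ = X + _ -> _]eq_bigr do rewrite row_mxEl.
    by under [X in _ = _ + X -> _]eq_bigr do rewrite row_mxEr.
  exists (U, u', v'); split=> //.
  by exists X, Y; rewrite -[Lt eps]hsubmxK.
(* Triples exist only for small [eps]; elsewhere a default is taken, which the filter at [0^'+] does
   not see. *)
have /choice[W HW] : forall eps, exists w, (exists w', good eps w') -> good eps w.
  move=> eps.
  have [[w gw]|nw] := pselect (exists w, good eps w); first by exists w.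
  by exists (1%:M, 0, 0).
pose U eps := (W eps).1.1; pose u eps := (W eps).1.2; pose v eps := (W eps).2.
have goodW : \forall eps \near 0^'+, good eps (U eps, u eps, v eps).
  near=> eps; have : good eps (W eps) by apply: HW; near: eps.
  by rewrite /U /u /v; case: (W eps) => [[]].
(* The corrected spectrum [u] has the trace of [L1] and differs from it by [O(eps)], so it is an
   admissible perturbation for the first block. *)
have [|| B1 [G1 [F1 [HB1 /bigO_sqrtP[a1 a10 G1n] /bigO_sqrtP[b1 b10 F1n]]]]] := H1 u.
- near=> eps; have [_ _ _ [tu _] _] : good eps (U eps, u eps, v eps) by near: eps.
  by rewrite !mxtrace_diag.
- apply/bigO_idP; exists (n1%:R * (K * C)); first exact: mulr_ge0.
  near=> eps; have [_ _ _ _ [eu _]] : good eps (U eps, u eps, v eps) by near: eps.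
  have eps0 : 0 < eps by [].
  rewrite ger0_norm ?frobenius_norm_ge0// -linearB /= -mulrA.
  apply: frobenius_diag_le; first by rewrite mulr_ge0// ltW.
  by move=> k; rewrite !mxE -mulrA.
have [|| B2 [G2 [F2 [HB2 /bigO_sqrtP[a2 a20 G2n] /bigO_sqrtP[b2 b20 F2n]]]]] := H2 v.
- near=> eps; have [_ _ _ [_ tv] _] : good eps (U eps, u eps, v eps) by near: eps.
  by rewrite !mxtrace_diag.
- apply/bigO_idP; exists (n2%:R * (K * C)); first exact: mulr_ge0.
  near=> eps; have [_ _ _ _ [_ ev]] : good eps (U eps, u eps, v eps) by near: eps.
  have eps0 : 0 < eps by [].
  rewrite ger0_norm ?frobenius_norm_ge0// -linearB /= -mulrA.
  apply: frobenius_diag_le; first by rewrite mulr_ge0// ltW.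
  by move=> k; rewrite !mxE -mulrA.
pose Q := block_mx Q1 0 0 Q2.
(* The rotation joins the inner factor, next to [Lt eps], so that the trace is redistributed before
   the factors of the blocks act. *)
pose G eps := block_mx (G1 eps) 0 0 (G2 eps) *m U eps.
pose F eps := block_mx (F1 eps) 0 0 (F2 eps).
pose P eps := F eps *m Q *m G eps.
have PE eps : P eps *m diag_mx (Lt eps) *m (P eps)^T =
    F eps *m Q *m G eps *m diag_mx (Lt eps) *m (G eps)^T *m Q^T *m (F eps)^T.
  by rewrite !trmx_mul !mulmxA.
have block_sub1 (M : 'M[R]_n1) (N : 'M[R]_n2) :
    frobenius_norm (block_mx M 0 0 N - 1%:M) ^+ 2 =
    frobenius_norm (M - 1%:M) ^+ 2 + frobenius_norm (N - 1%:M) ^+ 2.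
  rewrite -sqr_frobenius_norm_block_diag scalar_mx_block opp_block_mx.
  by rewrite add_block_mx !oppr0 !addr0.
exists (fun eps => P eps *m diag_mx (Lt eps) *m (P eps)^T), G, F; split.
- apply: filterS3 goodW HB1 HB2 => eps [oU [X [Y UE]] _ _ _].
  move=> [_ B1E dB1 oG1 oF1] [_ B2E dB2 oG2 oF2].
  split=> //; first exact: symmetric_conj_diag; last first.
  + exact: orthogonal_block_diag.
  + by apply: orthogonal_mx_mul => //; exact: orthogonal_block_diag.
  (* Conjugation by [U eps] produces diagonal blocks [u eps] and [v eps]; [V1] and [V2] then turn
     these into [B1 eps] and [B2 eps], while [X] and [Y] remain off the diagonal. *)
  pose V1 := F1 eps *m Q1 *m G1 eps; pose V2 := F2 eps *m Q2 *m G2 eps.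
  have -> : P eps = block_mx V1 0 0 V2 *m U eps.
    rewrite /P /G mulmxA !mulmx_block.
    by rewrite !(mulmx0, mul0mx, addr0, add0r).
  rewrite trmx_mul -!mulmxA (mulmxA (U eps)) (mulmxA (U eps *m _)) UE.
  rewrite tr_block_mx !trmx0 !mulmx_block !(mulmx0, mul0mx, addr0, add0r).
  have E1 : V1 *m (diag_mx (u eps) *m V1^T) = B1 eps.
    by rewrite B1E /V1 !trmx_mul !mulmxA.
  have E2 : V2 *m (diag_mx (v eps) *m V2^T) = B2 eps.
    by rewrite B2E /V2 !trmx_mul !mulmxA.
  rewrite E1 E2; apply/rowP => k; rewrite mxE [RHS]mxE.
  case: (splitP k) => l kl.
    rewrite (_ : k = lshift n2 l) ?block_mxEul; last exact: val_inj.
    by have /rowP/(_ l) := dB1; rewrite !mxE.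
  rewrite (_ : k = rshift n1 l) ?block_mxEdr; last exact: val_inj.
  by have /rowP/(_ l) := dB2; rewrite !mxE.
- apply/bigO_sqrtP; exists (2 * (a1 + a2 + K * C)).
    by rewrite mulr_ge0// !addr_ge0.
  near=> eps.
  have [oU _ Un _ _] : good eps (U eps, u eps, v eps) by near: eps.
  (* The orthogonal factor [U eps] drops out of the norm of the first summand; the 2 in the constant
     comes from [sqr_frobenius_normD]. *)
  have -> : G eps - 1%:M =
      (block_mx (G1 eps) 0 0 (G2 eps) - 1%:M) *m U eps + (U eps - 1%:M).
    by rewrite mulmxBl mul1mx addrA subrK.
  apply: le_trans (sqr_frobenius_normD _ _ _ _ _) _.
  rewrite frobenius_norm_mulr_orthogonal// block_sub1 -mulrA ler_pM2l// !mulrDl.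
  by rewrite -mulrA !lerD//; near: eps.
- apply/bigO_sqrtP; exists (b1 + b2); first exact: addr_ge0.
  near=> eps; rewrite block_sub1 mulrDl.
  by rewrite lerD//; near: eps.
Unshelve. all: by end_near. Qed.
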